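(* Let $R_1,R_2$ be nonnegative integers and let $x=(\alpha,0)$, $y=(\gamma,0)$ be points of $\mathbb{Z}^2$ with $\alpha<\gamma$ and $\gamma-\alpha\le R_1+R_2$. If $C_d(x,R_1)\cap C_d(y,R_2)\neq\emptyset$, then $$m\bigl(D_d(x,R_1),D_d(y,R_2)\bigr)=(R_1-R_2)^2+2(R_1+R_2+1)(\gamma-\alpha)-(\gamma-\alpha)^2.$$
   Context: The $\mathcal{L}_1$ metric on the digital plane $\mathbb{Z}^2$ is $d(p_1,p_2)=|a_1-a_2|+|b_1-b_2|$ for $p_1=(a_1,b_1)$, $p_2=(a_2,b_2)$. For $x\in\mathbb{Z}^2$ and a nonnegative integer $r$, the digital circle is $C_d(x,r)=\{z\in\mathbb{Z}^2 : d(x,z)=r\}$ and the digital disc is $D_d(x,r)=\{z\in\mathbb{Z}^2 : d(x,z)\le r\}$. For nonempty finite sets $A,B$, the Jaccard-like metric is $m(A,B)=\mathrm{card}(A\bigtriangleup B)=\mathrm{card}(A)+\mathrm{card}(B)-2\,\mathrm{card}(A\cap B)$. *)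

(* Defs.v *)
From mathcomp Require Import all_boot all_order all_algebra finmap.
From mathcomp Require Import zify.
From mathcomp Require Export boolp classical_sets functions cardinality.

Set Implicit Arguments.
Unset Strict Implicit.
Unset Printing Implicit Defensive.

Import Order.TTheory GRing.Theory Num.Theory.

Local Open Scope ring_scope.
Local Open Scope classical_set_scope.

Definition l1dist (p1 p2 : int * int) : int :=
  `|p1.1 - p2.1| + `|p1.2 - p2.2|.

Definition dcircle (x : int * int) (r : nat) : set (int * int) :=
  [set z | l1dist x z = r%:Z].

Definition ddisc (x : int * int) (r : nat) : set (int * int) :=
  [set z | l1dist x z <= r%:Z].

(* [fset_set] sends an infinite set to [fset0], so [card_set] and [jmetric]
   are only meaningful on finite sets; see [finite_ddisc]. *)
Definition card_set (T : choiceType) (A : set T) : nat := #|` fset_set A|.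

Definition jmetric (T : choiceType) (A B : set T) : nat := card_set (A `+` B).

Lemma finite_ddisc x r : finite_set (ddisc x r).
Proof.
pose f (p : nat * nat) : int * int :=
  (x.1 - r%:Z + p.1%:Z, x.2 - r%:Z + p.2%:Z).
apply: (@sub_finite_set _ _ (f @` (`I_(r + r).+1 `*` `I_(r + r).+1))); last first.
  by apply: finite_image; apply: finite_setX; apply: finite_II.
move=> [a b]; rewrite /ddisc /l1dist /= => h.
exists (absz (a - x.1 + r%:Z), absz (b - x.2 + r%:Z)); first by split => /=; lia.
by rewrite /f /=; congr pair; lia.
Qed.

Lemma ddisc_nonempty x r : ddisc x r !=set0.
Proof. by exists x; rewrite /ddisc /l1dist /= !subrr. Qed.

Lemma jmetricE (T : choiceType) (A B : set T) :
  finite_set A -> finite_set B ->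
  (jmetric A B)%:Z
    = (card_set A)%:Z + (card_set B)%:Z - 2 * (card_set (A `&` B))%:Z.
Proof.
move=> fA fB; rewrite /jmetric /card_set /setY.
rewrite fset_setU; [|exact: finite_setD..].
rewrite !fset_setD // fset_setI //.
set a := fset_set A; set b := fset_set B.
have ha := cardfsID b a; have hb := cardfsID a b.
rewrite fsetIC in hb.
have hU := cardfsUI (a `\` b)%fset (b `\` a)%fset.
have h0 : ((a `\` b) `&` (b `\` a))%fset = fset0.
  by apply/fsetP => t; rewrite !inE; case: (t \in a); case: (t \in b).
rewrite h0 cardfs0 addn0 in hU.
by lia.
Qed.

(* Main.v *)
Require Import Defs.
From mathcomp Require Import all_boot all_order all_algebra.
From mathcomp Require Import finmap zify ring.
Import Order.TTheory GRing.Theory Num.Theory.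
Local Open Scope ring_scope.
Local Open Scope classical_set_scope.

(** Since [jmetric] is |A| + |B| - 2 |A `&` B|, three cardinals are needed.

    A disc of radius r has r^2 + (r + 1)^2 points: rotated by 45 degrees it is
    two interleaved square grids, the points z at distance from the centre of
    the same parity as r and those of the opposite parity
    ([mem_ddisc_points], [card_ddisc]).

    The intersection is again a disc.  In the rotated coordinates a + b, a - b
    the two discs are squares centred on the diagonal, and they meet in the
    square where both coordinates lie between gamma - R2 and alpha + R1.  Its
    centre and its radius k = (R1 + R2 - (gamma - alpha)) / 2 are integral
    because a common point of the two circles makes R1 + R2 and gamma - alpha
    congruent modulo 2; it also gives |R1 - R2| <= gamma - alpha, without which
    the bounds of the square would come from one disc alone
    ([dcircle_meet_bounds], [ddiscI_ddisc]).  The formula is then algebra. *)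

Lemma card_set_seq (T : choiceType) (A : set T) (s : seq T) :
  uniq s -> (forall z, A z <-> z \in s) -> card_set A = size s.
Proof.
move=> us As; have -> : A = [set` s].
  by apply/seteqP; split=> z /As.
have fs : finite_set [set` s] by exact: finite_seq.
rewrite /card_set -[in RHS](undup_id us) -(card_fseq s); congr #|` _|.
by apply/fsetP => z; rewrite in_fset_set // !inE mem_setE.
Qed.

(** The n by n grid spanned by the diagonal steps (1, 1) and (1, -1), with
    leftmost point p. *)
Definition diagonal_grid (p : int * int) (n : nat) : seq (int * int) :=
  [seq (p.1 + i%:Z + j%:Z, p.2 + i%:Z - j%:Z) | i <- iota 0 n, j <- iota 0 n].

Lemma diagonal_gridP p n z :
  reflect (exists i j : nat, [/\ (i < n)%N, (j < n)%N &
            z = (p.1 + i%:Z + j%:Z, p.2 + i%:Z - j%:Z)])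
          (z \in diagonal_grid p n).
Proof.
apply: (iffP allpairsP) => [[[i j] [/=]]|[i [j [ltin ltjn ->]]]].
  by rewrite !mem_iota /= !add0n => ltin ltjn ->; exists i, j.
by exists (i, j); rewrite !mem_iota.
Qed.

Lemma size_diagonal_grid p n : size (diagonal_grid p n) = (n * n)%N.
Proof. by rewrite size_allpairs size_iota. Qed.

Lemma diagonal_grid_uniq p n : uniq (diagonal_grid p n).
Proof.
apply: allpairs_uniq; rewrite ?iota_uniq // => -[i j] [i' j'] _ _ /= [e1 e2].
by congr pair; lia.
Qed.

(** The two grids hold the points whose distance to x is congruent to r modulo
    2, and the others: each diagonal step preserves the parity of that
    distance. *)
Definition ddisc_points (x : int * int) (r : nat) : seq (int * int) :=
  diagonal_grid (x.1 - r%:Z, x.2) r.+1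
    ++ diagonal_grid (x.1 - r%:Z + 1, x.2) r.

(** The coordinates of z in a grid are half of (a + b) and of (a - b), measured
    from the starting point; the parity of a + b decides which grid applies. *)
Lemma mem_ddisc_points x r z : ddisc x r z <-> z \in ddisc_points x r.
Proof.
case: z => a b; rewrite mem_cat /ddisc /l1dist /=; split=> [dz|].
  pose u := a - x.1 + (b - x.2) + r%:Z; pose v := a - x.1 - (b - x.2) + r%:Z.
  have [evu | oddu] := boolP (2 %| u)%Z; apply/orP; [left | right];
    apply/diagonal_gridP.
  - exists (absz (u %/ 2)%Z), (absz (v %/ 2)%Z).
    by rewrite /u /v in evu *; split; [lia|lia|congr pair => /=; lia].
  - exists (absz ((u - 1) %/ 2)%Z), (absz ((v - 1) %/ 2)%Z).
    by rewrite /u /v in oddu *; split; [lia|lia|congr pair => /=; lia].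
by case/orP=> /diagonal_gridP[i [j [ltin ltjn [-> ->]]]] /=; lia.
Qed.

Lemma ddisc_points_uniq x r : uniq (ddisc_points x r).
Proof.
rewrite cat_uniq !diagonal_grid_uniq andbT /=; apply/hasPn => z.
case/diagonal_gridP=> i [j [_ _ ->]].
(* The sum of the coordinates has opposite parities on the two grids. *)
by apply/negP => /diagonal_gridP[i' [j' [_ _ [/= e1 e2]]]]; lia.
Qed.

Lemma card_ddisc x r : card_set (ddisc x r) = ((r + 1) ^ 2 + r ^ 2)%N.
Proof.
rewrite (card_set_seq _ _ _ (ddisc_points_uniq x r)).
  by rewrite size_cat !size_diagonal_grid -addn1.
exact: mem_ddisc_points.
Qed.

(** These coordinates turn an intersection of discs into intersections of
    intervals. *)
Lemma ddisc_rotated (c a b : int) (r : nat) :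
  ddisc (c, 0) r (a, b) <->
  [/\ c - r%:Z <= a + b, a + b <= c + r%:Z,
      c - r%:Z <= a - b & a - b <= c + r%:Z].
Proof.
by rewrite /ddisc /l1dist /=; split=> [h|[h1 h2 h3 h4]]; [split|]; lia.
Qed.

(** The centre c and the radius k come from the midpoint and the half-length of
    the interval from gamma - R2 to alpha + R1 that bounds a + b and a - b on
    the intersection.  The bounds on R1 - R2 say that this interval lies inside
    the corresponding interval of each disc. *)
Lemma ddiscI_ddisc (R1 R2 k : nat) (alpha gamma c : int) :
    2 * k%:Z = R1%:Z + R2%:Z - (gamma - alpha) ->
    2 * c = alpha + gamma + R1%:Z - R2%:Z ->
    R1%:Z - R2%:Z <= gamma - alpha -> R2%:Z - R1%:Z <= gamma - alpha ->
  ddisc (alpha, 0) R1 `&` ddisc (gamma, 0) R2 = ddisc (c, 0) k.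
Proof.
move=> Dk Dc le12 le21; apply/seteqP.
split=> -[a b].
  by case=> /ddisc_rotated[? ? ? ?] /ddisc_rotated[? ? ? ?];
    apply/ddisc_rotated; split; lia.
by move=> /ddisc_rotated[? ? ? ?]; split; apply/ddisc_rotated; split; lia.
Qed.

Lemma dcircle_meet_bounds (R1 R2 : nat) (alpha gamma : int) :
    alpha < gamma -> dcircle (alpha, 0) R1 `&` dcircle (gamma, 0) R2 !=set0 ->
  [/\ R1%:Z - R2%:Z <= gamma - alpha, R2%:Z - R1%:Z <= gamma - alpha &
      exists k : nat, 2 * k%:Z = R1%:Z + R2%:Z - (gamma - alpha)].
Proof.
move=> lt_ag [[a b]]; rewrite /dcircle /l1dist /= => -[h1 h2].
split; [lia|lia|].
(* |a - alpha| + |a - gamma| is congruent to gamma - alpha modulo 2, and the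
   ordinate contributes the even number 2 |b|. *)
by exists (absz ((R1%:Z + R2%:Z - (gamma - alpha)) %/ 2)%Z); lia.
Qed.

Theorem theorem3 (R1 R2 : nat) (alpha gamma : int)
    (x y : int * int) (hx : x = (alpha, 0)) (hy : y = (gamma, 0))
    (hlt : alpha < gamma) (hle : gamma - alpha <= R1%:Z + R2%:Z)
    (hC : dcircle x R1 `&` dcircle y R2 !=set0) :
  (jmetric (ddisc x R1) (ddisc y R2))%:Z
    = (R1%:Z - R2%:Z) ^+ 2 + 2 * (R1%:Z + R2%:Z + 1) * (gamma - alpha)
      - (gamma - alpha) ^+ 2.
Proof.
subst x y; have [le12 le21 [k Dk]] := dcircle_meet_bounds _ _ _ _ hlt hC.
rewrite jmetricE; [|exact: finite_ddisc..].
have Dc : 2 * (alpha + R1%:Z - k%:Z) = alpha + gamma + R1%:Z - R2%:Z by lia.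
rewrite (ddiscI_ddisc _ _ _ _ _ _ Dk Dc le12 le21) !card_ddisc.
have -> : gamma - alpha = R1%:Z + R2%:Z - 2 * k%:Z by lia.
by rewrite -!mulnn !PoszD !PoszM !PoszD; ring.
Qed.
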